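(* Let $m\in\frac32+\mathbb Z_{\ge0}$. For all $k\in\mathbb Z_{\ge0}$, $$F_{k,m}(\kappa_{\theta_1}h_t\kappa_{\theta_2})=\chi_{m+2k}(\kappa_{\theta_1})\,\frac{\tanh^k(t)}{\cosh^m(t)}\,\chi_m(\kappa_{\theta_2}),\qquad\theta_1,\theta_2\in\mathbb R,\ t\in\mathbb R_{\ge0}.$$
   Context: Let $\mathcal H=\{z\in\mathbb C:\Im z>0\}$, let $\mathrm{Hol}(\mathcal H)$ be the space of holomorphic functions on $\mathcal H$, and let $g.z=\frac{az+b}{cz+d}$, $j(g,z)=cz+d$ for $g=\begin{pmatrix}a&b\\c&d\end{pmatrix}$. The square root $\sqrt{\cdot}$ is the branch with values in $\{\Re>0\}\cup\{\Re=0,\Im\ge0\}$, and $z^m:=(\sqrt z)^{2m}$ for half-integral $m$. The metaplectic group is $\mathrm{SL}_2(\mathbb R)^\sim=\{\sigma=(g_\sigma,\eta_\sigma)\in\mathrm{SL}_2(\mathbb R)\times\mathrm{Hol}(\mathcal H):\eta_\sigma(z)^2=j(g_\sigma,z)\ \forall z\in\mathcal H\}$ with multiplication $\sigma_1\sigma_2=(g_{\sigma_1}g_{\sigma_2},\ \eta_{\sigma_1}(g_{\sigma_2}.z)\eta_{\sigma_2}(z))$. An element $\sigma$ is determined by $(g_\sigma,\eta_\sigma(i))$, and we write $\sigma\equiv(g_\sigma,\eta_\sigma(i))$. Put $\kappa_t=\left(\begin{pmatrix}\cos t&-\sin t\\\sin t&\cos t\end{pmatrix},e^{it/2}\right)$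 for $t\in\mathbb R$ and $h_t=\left(\begin{pmatrix}e^t&0\\0&e^{-t}\end{pmatrix},e^{-t/2}\right)$ for $t\in\mathbb R_{\ge0}$. On $K=\{\kappa_t:t\in\mathbb R\}$ put $\chi_n(\kappa_t)=e^{-int}$, $n\in\frac12\mathbb Z$. For $k\in\mathbb Z_{\ge0}$, $f_{k,m}(z)=(2i)^m\frac{(z-i)^k}{(z+i)^{m+k}}$ for $z\in\mathcal H$, and $F_{k,m}(\sigma)=f_{k,m}(g_\sigma.i)\,\eta_\sigma(i)^{-2m}$ for $\sigma\in\mathrm{SL}_2(\mathbb R)^\sim$. (For $k=0$, $\tanh^0(t)=1$.) *)

(* Defs.v *)
From Stdlib Require Import Reals Ranalysis5 Lra Lia Psatz ZArith.
From Stdlib Require Import ClassicalEpsilon FunctionalExtensionality ProofIrrelevance.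
From Coquelicot Require Import Coquelicot.

Open Scope R_scope.

Definition Cexp (z : C) : C :=
  (RtoC (exp (Re z)) * (cos (Im z), sin (Im z)))%C.

Definition Cpowz (z : C) (n : Z) : C :=
  match n with
  | Z0 => RtoC 1
  | Zpos p => (z ^ Pos.to_nat p)%C
  | Zneg p => (/ (z ^ Pos.to_nat p))%C
  end.

(* The half-angle formula for the branch of the square root with values in
   {Re > 0} \/ {Re = 0, Im >= 0}; see [Csqrt_sqr] and [Csqrt_branch]. *)
Definition Csqrt (z : C) : C :=
  (sqrt ((Cmod z + Re z) / 2),
   if Rle_dec 0 (Im z) then sqrt ((Cmod z - Re z) / 2)
   else - sqrt ((Cmod z - Re z) / 2)).

Definition half_integral (m : R) : Prop := exists N : Z, 2 * m = IZR N.

(* The integer 2m; only meaningful for half-integral m, see [twiceE]. *)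
Definition twice (m : R) : Z := Int_part (2 * m).

Definition Cpow_half (z : C) (m : R) : C := Cpowz (Csqrt z) (twice m).

Lemma twiceE (m : R) : half_integral m -> IZR (twice m) = 2 * m.
Proof.
  intros [N HN]. unfold twice. rewrite HN.
  rewrite <- (Int_part_spec (IZR N) N); [reflexivity | lra].
Qed.

Lemma Cmod_bounds (z : C) : 0 <= Cmod z + Re z /\ 0 <= Cmod z - Re z.
Proof.
  generalize (re_le_Cmod z). intros H.
  apply Rabs_le_between in H. lra.
Qed.

Lemma Csqrt_sqr (z : C) : (Csqrt z * Csqrt z)%C = z.
Proof.
  destruct (Cmod_bounds z) as [H1 H2].
  assert (HM := Cmod2_alt z).
  unfold Csqrt. set (p := (Cmod z + Re z) / 2). set (q := (Cmod z - Re z) / 2).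
  assert (Hp : 0 <= p) by (unfold p; lra).
  assert (Hq : 0 <= q) by (unfold q; lra).
  assert (Sp := sqrt_sqrt p Hp). assert (Sq := sqrt_sqrt q Hq).
  assert (E : sqrt p * sqrt q = Rabs (Im z) / 2).
  { rewrite <- sqrt_mult by assumption.
    replace (p * q) with (Rsqr (Im z / 2)).
    - rewrite sqrt_Rsqr_abs. unfold Rdiv. rewrite Rabs_mult.
      rewrite (Rabs_right (/ 2)); lra.
    - unfold p, q, Rsqr. nra. }
  transitivity (Re z, Im z); [| now destruct z]. unfold Cmult; simpl.
  destruct (Rle_dec 0 (Im z)) as [Hi | Hi]; apply injective_projections; simpl.
  - rewrite Sp, Sq. unfold p, q. lra.
  - rewrite Rabs_right in E by lra. nra.
  - replace (sqrt p * sqrt p - - sqrt q * - sqrt q)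
      with (sqrt p * sqrt p - sqrt q * sqrt q) by ring.
    rewrite Sp, Sq. unfold p, q. lra.
  - rewrite Rabs_left in E by lra. nra.
Qed.

Lemma Csqrt_Re_ge0 (z : C) : 0 <= Re (Csqrt z).
Proof. apply sqrt_pos. Qed.

Lemma Csqrt_Re_gt0 (z : C) : 0 < Re z \/ Im z <> 0 -> 0 < Re (Csqrt z).
Proof.
  intros H. destruct (Cmod_bounds z) as [H1 H2]. assert (HM := Cmod2_alt z).
  apply sqrt_lt_R0.
  destruct (Rle_lt_or_eq_dec _ _ H1) as [Hl | He]; [lra | exfalso].
  destruct H as [H | H].
  - generalize (Cmod_ge_0 z). lra.
  - apply H. apply Rsqr_0_uniq. unfold Rsqr.
    replace (Cmod z) with (- Re z) in HM by lra. nra.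
Qed.

Lemma Csqrt_branch (z : C) :
  0 < Re (Csqrt z) \/ (Re (Csqrt z) = 0 /\ 0 <= Im (Csqrt z)).
Proof.
  destruct (Rle_dec 0 (Im z)) as [Hi | Hi].
  - destruct (Rle_lt_or_eq_dec _ _ (Csqrt_Re_ge0 z)) as [Hl | He];
      [now left | right]. split; [now symmetry |].
    unfold Csqrt, Im at 1; simpl. destruct (Rle_dec 0 (Im z)); [| contradiction].
    apply sqrt_pos.
  - left. apply Csqrt_Re_gt0. right. lra.
Qed.

Record UHP := mkUHP { uhp_val :> C; uhp_pos : 0 < Im uhp_val }.

Definition iH : UHP := mkUHP Ci Rlt_0_1.

Definition extend (f : UHP -> C) (z : C) : C :=
  match Rlt_dec 0 (Im z) with
  | left Hz => f (mkUHP z Hz)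
  | right _ => RtoC 0
  end.

(* As the upper half-plane is open, complex differentiability of [f] at [z]
   does not depend on how [f] is extended to C. *)
Definition holomorphic (f : UHP -> C) : Prop :=
  forall z : UHP, ex_derive (K := C_AbsRing) (V := C_NormedModule)
    (extend f) (uhp_val z).

Record Hol := mkHol { hol_fun :> UHP -> C; hol_prop : holomorphic hol_fun }.

Record SL2R := mkSL2R {
  ga : R; gb : R; gc : R; gd : R;
  g_det : ga * gd - gb * gc = 1 }.

Lemma SL2R_mul_det (g h : SL2R) :
  (ga g * ga h + gb g * gc h) * (gc g * gb h + gd g * gd h) -
  (ga g * gb h + gb g * gd h) * (gc g * ga h + gd g * gc h) = 1.
Proof.
  destruct g as [a b c d H], h as [a' b' c' d' H']; simpl.
  replace 1 with ((a * d - b * c) * (a' * d' - b' * c')) by (rewrite H, H'; ring).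
  ring.
Qed.

Definition SL2R_mul (g h : SL2R) : SL2R :=
  mkSL2R (ga g * ga h + gb g * gc h) (ga g * gb h + gb g * gd h)
         (gc g * ga h + gd g * gc h) (gc g * gb h + gd g * gd h)
         (SL2R_mul_det g h).

Definition jC (g : SL2R) (z : C) : C := (RtoC (gc g) * z + RtoC (gd g))%C.

Definition mobius (g : SL2R) (z : C) : C :=
  ((RtoC (ga g) * z + RtoC (gb g)) / jC g z)%C.

Definition j (g : SL2R) (z : UHP) : C := jC g z.

Lemma jC_neq0 (g : SL2R) (z : C) : 0 < Im z -> jC g z <> RtoC 0.
Proof.
  destruct g as [a b c d H]. unfold jC; simpl. intros Hz E.
  assert (E1 := f_equal Re E). assert (E2 := f_equal Im E).
  rewrite re_plus, re_scal_l, !re_RtoC in E1.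
  rewrite im_plus, im_scal_l, !im_RtoC in E2.
  assert (Hc : c = 0) by nra. subst c. assert (Hd : d = 0) by nra. subst d. lra.
Qed.

Lemma Im_mobius (g : SL2R) (z : C) :
  0 < Im z -> Im (mobius g z) = Im z / Cmod (jC g z) ^ 2.
Proof.
  intros Hz. assert (Hj := jC_neq0 g z Hz). assert (Hm := Cmod2_alt (jC g z)).
  assert (Hp : 0 < Cmod (jC g z)) by now apply Cmod_gt_0.
  assert (Hp2 : 0 < Cmod (jC g z) ^ 2) by nra.
  rewrite Hm in *. clear Hm Hj Hp.
  destruct g as [a b c d H], z as [x y]. revert Hp2. unfold mobius, jC; simpl in *.
  intros Hp2. field_simplify_eq; [| lra].
  transitivity (y * (a * d - b * c)); [ring | rewrite H; ring].
Qed.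

Lemma mobius_pos (g : SL2R) (z : C) : 0 < Im z -> 0 < Im (mobius g z).
Proof.
  intros Hz. rewrite Im_mobius by exact Hz. apply Rdiv_lt_0_compat; [exact Hz |].
  apply pow_lt. apply Cmod_gt_0. now apply jC_neq0.
Qed.

Definition act (g : SL2R) (z : UHP) : UHP :=
  mkUHP (mobius g z) (mobius_pos g z (uhp_pos z)).

Lemma is_derive_quad (f : C -> C) (z l : C) (M : R) (d : posreal) :
  (forall w : C, Cmod (w - z) < d ->
     Cmod (f w - f z - l * (w - z)) <= M * Cmod (w - z) ^ 2) ->
  is_derive (K := C_AbsRing) (V := C_NormedModule) f z l.
Proof.
  intros H. split; [apply is_linear_scal_l |].
  intros x Hx.
  apply (is_filter_lim_locally_unique (V := AbsRing_NormedModule C_AbsRing) z x) in Hx.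
  subst x. intros eps.
  assert (HM : 0 < Rabs M + 1) by (generalize (Rabs_pos M); lra).
  assert (Hd : 0 < Rmin d (eps / (Rabs M + 1))).
  { apply Rmin_pos; [apply cond_pos |].
    apply Rdiv_lt_0_compat; [apply cond_pos | exact HM]. }
  exists (mkposreal _ Hd). intros w Hw. change (Cmod (w - z) < Rmin d (eps / (Rabs M + 1))) in Hw.
  change (Cmod (f w - f z - (w - z) * l) <= eps * Cmod (w - z)).
  rewrite (Cmult_comm (w - z)).
  assert (H1 := Rlt_le_trans _ _ _ Hw (Rmin_l _ _)).
  assert (H2 := Rlt_le_trans _ _ _ Hw (Rmin_r _ _)).
  eapply Rle_trans; [apply H, H1 |].
  assert (H3 : Cmod (w - z) * (Rabs M + 1) <= eps).
  { apply Rlt_le. apply (Rmult_lt_compat_r _ _ _ HM) in H2.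
    replace (eps / (Rabs M + 1) * (Rabs M + 1)) with (pos eps) in H2 by (field; lra).
    exact H2. }
  assert (H4 := Cmod_ge_0 (w - z)). assert (H5 := Rle_abs M).
  simpl. nra.
Qed.

Lemma is_derive_AbsRing (f : C -> C) (z l : C) :
  is_derive (K := C_AbsRing) (V := C_NormedModule) f z l <->
  is_derive (K := C_AbsRing) (V := AbsRing_NormedModule C_AbsRing) f z l.
Proof.
  split; intros [_ H]; split; try apply is_linear_scal_l; exact H.
Qed.

Lemma ex_derive_Csqrt (z : C) :
  0 < Re z \/ Im z <> 0 ->
  ex_derive (K := C_AbsRing) (V := C_NormedModule) Csqrt z.
Proof.
  intros Hz. assert (Hr := Csqrt_Re_gt0 z Hz).
  set (s := Csqrt z) in *. set (r := Re s) in *.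
  assert (Hs : s <> RtoC 0).
  { intros E. unfold r in Hr. rewrite E in Hr. simpl in Hr. lra. }
  assert (Hrs : r <= Cmod s).
  { generalize (re_le_Cmod s) (Rle_abs (Re s)). fold r. lra. }
  exists (/ (2 * s))%C.
  apply is_derive_quad with (M := / (2 * r ^ 3)) (d := mkposreal 1 Rlt_0_1).
  intros w _. fold s. set (u := Csqrt w).
  assert (Eu : (u * u)%C = w) by apply Csqrt_sqr.
  assert (Es : (s * s)%C = z) by apply Csqrt_sqr.
  assert (Hu : 0 <= Re u) by apply Csqrt_Re_ge0.
  assert (Hus : r <= Cmod (u + s)).
  { generalize (re_le_Cmod (u + s)) (Rle_abs (Re (u + s))).
    rewrite re_plus. fold r. lra. }
  rewrite <- Eu, <- Es.
  replace (u * u - s * s)%C with ((u - s) * (u + s))%C by ring.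
  replace (u - s - / (2 * s) * ((u - s) * (u + s)))%C
    with (- ((u - s) * (u - s)) * / (2 * s))%C by (field; exact Hs).
  rewrite !Cmod_mult, Cmod_opp, Cmod_mult.
  rewrite Cmod_inv by (apply Cmult_neq_0; [| exact Hs]; intros E;
    apply RtoC_inj in E; lra).
  rewrite Cmod_mult, Cmod_R, Rabs_right by lra.
  assert (H0 := Cmod_ge_0 (u - s)).
  set (p := Cmod (u - s)) in *. set (q := Cmod (u + s)) in *. set (v := Cmod s) in *.
  assert (A : / (2 * v) <= / (2 * r)) by (apply Rinv_le_contravar; lra).
  assert (Ep : 0 <= p * p) by nra.
  apply Rle_trans with (p * p * / (2 * r)); [nra |].
  assert (Hq : 0 <= q * q - r * r) by nra.
  replace (p * p * / (2 * r)) with (/ (2 * r ^ 3) * (p * p * (r * r))) by (field; lra).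
  apply Rmult_le_compat_l.
  - apply Rlt_le, Rinv_0_lt_compat. assert (0 < r ^ 3) by now apply pow_lt. lra.
  - nra.
Qed.

Lemma Im_near (w z : C) : Cmod (w - z) < Im z -> 0 < Im w.
Proof.
  intros H. generalize (Rmax_Cmod (w - z)%C).
  generalize (Rmax_r (Rabs (fst (w - z)%C)) (Rabs (snd (w - z)%C))).
  assert (D := Rle_abs (- snd (w - z)%C)). rewrite Rabs_Ropp in D.
  change (snd (w - z)%C) with (Im w + - Im z) in *. lra.
Qed.

Lemma ex_derive_mobius (g : SL2R) (z : C) :
  0 < Im z ->
  ex_derive (K := C_AbsRing) (V := AbsRing_NormedModule C_AbsRing) (mobius g) z.
Proof.
  intros Hz. assert (Hj := jC_neq0 g z Hz).
  exists (/ (jC g z * jC g z))%C.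
  assert (Hp : 0 < Cmod (jC g z)) by now apply Cmod_gt_0.
  set (d := Rmin (Im z) (Cmod (jC g z) / 2 / (Rabs (gc g) + 1))).
  assert (HC : 0 < Rabs (gc g) + 1) by (generalize (Rabs_pos (gc g)); lra).
  assert (Hd : 0 < d).
  { apply Rmin_pos; [exact Hz | apply Rdiv_lt_0_compat; lra]. }
  apply is_derive_AbsRing, is_derive_quad with
    (M := Rabs (gc g) * (2 / Cmod (jC g z) ^ 3)) (d := mkposreal d Hd).
  intros w Hw. simpl in Hw.
  assert (H1 := Rlt_le_trans _ _ _ Hw (Rmin_l _ _)).
  assert (H2 := Rlt_le_trans _ _ _ Hw (Rmin_r _ _)).
  assert (Hwi : 0 < Im w) by now apply Im_near with z.
  assert (Hjw := jC_neq0 g w Hwi).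
  assert (Hjwz : (jC g w - jC g z)%C = (RtoC (gc g) * (w - z))%C)
    by (unfold jC; ring).
  assert (HB : Cmod (jC g z) / 2 <= Cmod (jC g w)).
  { assert (T := Cmod_triangle (jC g w) (- (RtoC (gc g) * (w - z)))).
    rewrite <- Hjwz in T at 1.
    replace (jC g w + - (jC g w - jC g z))%C with (jC g z) in T by ring.
    rewrite Cmod_opp, Cmod_mult, Cmod_R in T.
    assert (Cmod (w - z) * (Rabs (gc g) + 1) <= Cmod (jC g z) / 2).
    { apply Rlt_le. apply (Rmult_lt_compat_r _ _ _ HC) in H2.
      replace (Cmod (jC g z) / 2 / (Rabs (gc g) + 1) * (Rabs (gc g) + 1))
        with (Cmod (jC g z) / 2) in H2 by (field; lra).
      exact H2. }
    generalize (Cmod_ge_0 (w - z)). nra. }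
  assert (E : (mobius g w - mobius g z - / (jC g z * jC g z) * (w - z))%C =
    (- (RtoC (gc g) * ((w - z) * (w - z))) * / (jC g w * (jC g z * jC g z)))%C).
  { assert (F : (mobius g w - mobius g z)%C = ((w - z) / (jC g w * jC g z))%C).
    { unfold mobius.
      assert (Hdet : (RtoC (ga g) * RtoC (gd g) - RtoC (gb g) * RtoC (gc g))%C = RtoC 1).
      { rewrite <- !RtoC_mult, <- RtoC_minus. now rewrite g_det. }
      replace ((w - z) / (jC g w * jC g z))%C with
        ((RtoC (ga g) * RtoC (gd g) - RtoC (gb g) * RtoC (gc g)) * (w - z)
          / (jC g w * jC g z))%C by (rewrite Hdet; field; now split).
      unfold jC in *. field. now split. }
    rewrite F.
    replace (RtoC (gc g) * ((w - z) * (w - z)))%C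
      with ((jC g w - jC g z) * (w - z))%C by (rewrite Hjwz; ring).
    field. now split. }
  rewrite E. clear E.
  rewrite Cmod_mult, Cmod_opp, !Cmod_mult, Cmod_R.
  rewrite Cmod_inv by now repeat apply Cmult_neq_0.
  rewrite !Cmod_mult.
  set (p := Cmod (w - z)) in *. set (a := Cmod (jC g z)) in *. set (b := Cmod (jC g w)) in *.
  replace (Rabs (gc g) * (2 / a ^ 3) * p ^ 2)
    with (Rabs (gc g) * (p * p) * (/ (a / 2 * (a * a)))) by (field; lra).
  apply Rmult_le_compat_l.
  - apply Rmult_le_pos; [apply Rabs_pos | nra].
  - apply Rinv_le_contravar; [assert (0 < a * a) by nra; nra |].
    apply Rmult_le_compat_r; nra.
Qed.

Lemma extend_UHP (f : UHP -> C) (z : UHP) : extend f z = f z.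
Proof.
  unfold extend. destruct (Rlt_dec 0 (Im z)) as [H | H].
  - destruct z as [z Hz]; simpl in *. now rewrite (proof_irrelevance _ H Hz).
  - destruct H. apply uhp_pos.
Qed.

Lemma locally_UHP (z : UHP) (P : C -> Prop) :
  (forall w : UHP, P w) -> locally (T := AbsRing_UniformSpace C_AbsRing) (z : C) P.
Proof.
  intros H. exists (mkposreal _ (uhp_pos z)). intros w Hw.
  change (Cmod (w - uhp_val z)%C < Im z) in Hw.
  assert (Hwi : 0 < Im w) by now apply Im_near with (uhp_val z).
  exact (H (mkUHP w Hwi)).
Qed.

Lemma holomorphic_restrict (F : C -> C) (f : UHP -> C) :
  (forall z : UHP, f z = F z) ->
  (forall z : UHP, ex_derive (K := C_AbsRing) (V := C_NormedModule) F (uhp_val z)) ->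
  holomorphic f.
Proof.
  intros E H z. apply ex_derive_ext_loc with (f := F); [| apply H].
  apply locally_UHP. intros w. now rewrite extend_UHP.
Qed.

Lemma holomorphic_mul (f g : UHP -> C) :
  holomorphic f -> holomorphic g -> holomorphic (fun z => f z * g z)%C.
Proof.
  intros Hf Hg. apply holomorphic_restrict with (fun z => extend f z * extend g z)%C.
  - intros z. now rewrite !extend_UHP.
  - intros z. destruct (Hf z) as [l Hl], (Hg z) as [l' Hl']. eexists.
    apply is_derive_AbsRing, (is_derive_mult (K := C_AbsRing));
      [apply is_derive_AbsRing, Hl | apply is_derive_AbsRing, Hl' | exact Cmult_comm].
Qed.

Lemma holomorphic_act (f : UHP -> C) (g : SL2R) :
  holomorphic f -> holomorphic (fun z => f (act g z)).
Proof.
  intros Hf. apply holomorphic_restrict with (fun z => extend f (mobius g z)).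
  - intros z. now rewrite <- (extend_UHP f (act g z)).
  - intros z. apply (ex_derive_comp (K := C_AbsRing) (V := C_NormedModule)).
    + exact (Hf (act g z)).
    + apply ex_derive_mobius, uhp_pos.
Qed.

Lemma ex_derive_jC (g : SL2R) (z : C) :
  ex_derive (K := C_AbsRing) (V := AbsRing_NormedModule C_AbsRing) (jC g) z.
Proof.
  exists (RtoC (gc g)).
  apply is_derive_AbsRing, is_derive_quad with (M := 0) (d := mkposreal 1 Rlt_0_1). intros w _.
  replace (jC g w - jC g z - RtoC (gc g) * (w - z))%C with (RtoC 0)
    by (unfold jC; ring).
  rewrite Cmod_0. lra.
Qed.

Record Mp2 := mkMp2 {
  mp_g : SL2R;
  mp_eta : Hol;
  mp_sq : forall z : UHP, (mp_eta z ^ 2)%C = j mp_g z }.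

Lemma jC_cocycle (g h : SL2R) (z : UHP) :
  j (SL2R_mul g h) z = (j g (act h z) * j h z)%C.
Proof.
  assert (Hj := jC_neq0 h z (uhp_pos z)). unfold j. simpl. unfold mobius.
  unfold jC in *. simpl. rewrite !RtoC_plus, !RtoC_mult. field. exact Hj.
Qed.

Lemma Mp2_mul_holomorphic (s1 s2 : Mp2) :
  holomorphic (fun z => mp_eta s1 (act (mp_g s2) z) * mp_eta s2 z)%C.
Proof.
  apply holomorphic_mul; [apply holomorphic_act |]; apply hol_prop.
Qed.

Lemma Mp2_mul_sq (s1 s2 : Mp2) (z : UHP) :
  ((mkHol _ (Mp2_mul_holomorphic s1 s2) z) ^ 2)%C
    = j (SL2R_mul (mp_g s1) (mp_g s2)) z.
Proof. simpl hol_fun. now rewrite Cpow_mult_l, !mp_sq, jC_cocycle. Qed.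

Definition Mp2_mul (s1 s2 : Mp2) : Mp2 :=
  mkMp2 (SL2R_mul (mp_g s1) (mp_g s2)) (mkHol _ (Mp2_mul_holomorphic s1 s2))
        (Mp2_mul_sq s1 s2).

Definition lift_eta (g : SL2R) (w : C) (z : UHP) : C :=
  (w / Csqrt (j g iH) * Csqrt (j g z))%C.

Lemma lift_holomorphic (g : SL2R) (w : C) : holomorphic (lift_eta g w).
Proof.
  destruct (Req_dec (gc g) 0) as [Hc | Hc].
  - apply holomorphic_restrict with
      (fun _ => w / Csqrt (j g iH) * Csqrt (RtoC (gd g)))%C.
    + intros z. unfold lift_eta. f_equal. f_equal. unfold j, jC. rewrite Hc. ring.
    + intros z. apply ex_derive_const.
  - apply holomorphic_mul.
    + apply holomorphic_restrict with (fun _ => w / Csqrt (j g iH))%C.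
      * reflexivity.
      * intros z. apply ex_derive_const.
    + apply holomorphic_restrict with (fun z => Csqrt (jC g z)).
      * reflexivity.
      * intros z. apply (ex_derive_comp (K := C_AbsRing) (V := C_NormedModule)).
        -- apply ex_derive_Csqrt. right. unfold jC.
           rewrite im_plus, im_scal_l, im_RtoC, Rplus_0_r.
           generalize (uhp_pos z). intros Hz. apply Rmult_integral_contrapositive. lra.
        -- apply ex_derive_jC.
Qed.

Lemma Csqrt_neq0 (z : C) : z <> RtoC 0 -> Csqrt z <> RtoC 0.
Proof. intros Hz E. apply Hz. rewrite <- (Csqrt_sqr z), E. ring. Qed.

Lemma lift_sq (g : SL2R) (w : C) (Hw : (w ^ 2)%C = j g iH) (z : UHP) :
  (mkHol _ (lift_holomorphic g w) z ^ 2)%C = j g z.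
Proof.
  simpl hol_fun. unfold lift_eta.
  assert (Hj : j g iH <> RtoC 0) by apply jC_neq0, (uhp_pos iH).
  assert (Hs := Csqrt_neq0 _ Hj).
  replace ((w / Csqrt (j g iH) * Csqrt (j g z)) ^ 2)%C
    with (w ^ 2 / (Csqrt (j g iH) * Csqrt (j g iH)) * (Csqrt (j g z) * Csqrt (j g z)))%C
    by (field; exact Hs).
  rewrite !Csqrt_sqr, Hw. field. exact Hj.
Qed.

(* The only (g, eta) with eta(i) = w; see [lift_eta_i] and [lift_unique]. *)
Definition lift (g : SL2R) (w : C) (Hw : (w ^ 2)%C = j g iH) : Mp2 :=
  mkMp2 g (mkHol _ (lift_holomorphic g w)) (lift_sq g w Hw).

Lemma lift_eta_i (g : SL2R) (w : C) (Hw : (w ^ 2)%C = j g iH) :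
  mp_eta (lift g w Hw) iH = w.
Proof.
  simpl. unfold lift_eta.
  assert (Hj : j g iH <> RtoC 0) by apply jC_neq0, (uhp_pos iH).
  assert (Hs := Csqrt_neq0 _ Hj). field. exact Hs.
Qed.

Lemma continuous_extend (f : UHP -> C) (z : UHP) :
  holomorphic f ->
  continuous (T := C_UniformSpace) (U := C_UniformSpace) (extend f) (uhp_val z).
Proof.
  intros Hf. generalize (ex_derive_continuous _ _ (Hf z)).
  intros H P HP. apply locally_C. exact (H P HP).
Qed.

Definition segment (z : C) (s : R) : C := (s * Re z, 1 + s * (Im z - 1)).

Lemma Mp2_determined (s1 s2 : Mp2) :
  mp_g s1 = mp_g s2 -> mp_eta s1 iH = mp_eta s2 iH -> s1 = s2.
Proof.
  destruct s1 as [g e1 H1], s2 as [g' e2 H2]; simpl. intros <- Hi.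
  assert (E : e1 = e2).
  { assert (E : hol_fun e1 = hol_fun e2).
    { apply functional_extensionality. intros z.
      assert (Hsq : forall w, e1 w = e2 w \/ e1 w = (- e2 w)%C).
      { intros w.
        assert (Hw : ((e1 w - e2 w) * (e1 w + e2 w))%C = RtoC 0).
        { transitivity (e1 w ^ 2 - e2 w ^ 2)%C; [ring |]. rewrite H1, H2. ring. }
        destruct (Ceq_dec (e1 w - e2 w) 0) as [D | D].
        - left. now apply Ceq_minus.
        - right. destruct (Ceq_dec (e1 w + e2 w) 0) as [D' | D'].
          + apply Ceq_minus. rewrite <- D'. ring.
          + now destruct (Cmult_neq_0 _ _ D D'). }
      assert (Hnz : forall w, 0 < Re (e2 w) * Re (e2 w) + Im (e2 w) * Im (e2 w)).
      { intros w. assert (Hj := jC_neq0 g w (uhp_pos w)).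
        fold (j g w) in Hj. rewrite <- H2 in Hj.
        assert (N : e2 w <> RtoC 0) by (intros N; apply Hj; rewrite N; ring).
        apply Cmod_gt_0 in N. generalize (Cmod2_alt (e2 w)). nra. }
      destruct (Hsq z) as [D | D]; [exact D | exfalso].
      set (phi := fun s => - (Re (extend e1 (segment z s)) * Re (extend e2 (segment z s))
                   + Im (extend e1 (segment z s)) * Im (extend e2 (segment z s)))).
      assert (Hseg : forall s, 0 <= s <= 1 -> 0 < Im (segment z s)).
      { intros s Hs. simpl. generalize (uhp_pos z). intros Hz. nra. }
      assert (Hcont : forall (e : Hol) s, 0 <= s <= 1 ->
        continuous (T := R_UniformSpace) (U := C_UniformSpace)
          (fun s => extend e (segment z s)) s).
      { intros e s Hs.
        apply (continuous_comp (U := R_UniformSpace) (V := C_UniformSpace)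
                 (W := C_UniformSpace)).
        - intros P [d HP].
          assert (C1 : continuous (fun s => s * Re z) s).
          { apply continuity_pt_filterlim. reg. }
          assert (C2 : continuous (fun s => 1 + s * (Im z - 1)) s).
          { apply continuity_pt_filterlim. reg. }
          generalize (C1 _ (locally_ball _ d)) (C2 _ (locally_ball _ d)).
          intros [d1 A] [d2 B].
          exists (mkposreal _ (Rmin_pos d1 d2 (cond_pos d1) (cond_pos d2))).
          intros x X. apply HP. split.
          + apply A. exact (ball_le _ _ _ (Rmin_l _ _) _ X).
          + apply B. exact (ball_le _ _ _ (Rmin_r _ _) _ X).
        - exact (continuous_extend e (mkUHP _ (Hseg s Hs)) (hol_prop e)). }
      assert (Hphi : forall s, 0 <= s <= 1 -> continuity_pt phi s).
      { intros s Hs. apply continuity_pt_filterlim.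
        assert (P : forall e : Hol, continuous (fun s => Re (extend e (segment z s))) s /\
                   continuous (fun s => Im (extend e (segment z s))) s).
        { intros e. split.
          - apply (continuous_comp (V := C_UniformSpace) (fun s => extend e (segment z s)) fst _ (Hcont e s Hs)).
            apply continuous_fst.
          - apply (continuous_comp (V := C_UniformSpace) (fun s => extend e (segment z s)) snd _ (Hcont e s Hs)).
            apply continuous_snd. }
        destruct (P e1) as [A1 B1], (P e2) as [A2 B2].
        apply (continuous_opp (V := R_NormedModule)), (continuous_plus (V := R_NormedModule));
          apply (continuous_mult (K := R_AbsRing)); assumption. }
      assert (S0 : segment z 0 = iH).
      { apply injective_projections; simpl; ring. }
      assert (S1 : segment z 1 = z).
      { apply injective_projections; simpl; unfold Re, Im; ring. }
      destruct (IVT_interv phi 0 1 Hphi) as [s [Hs Es]]; [lra | | |].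
      - unfold phi. rewrite S0, !extend_UHP, Hi. generalize (Hnz iH). lra.
      - unfold phi. rewrite S1, !extend_UHP, D, re_opp, im_opp. generalize (Hnz z). lra.
      - set (w := mkUHP _ (Hseg s Hs)).
        unfold phi in Es. change (segment z s) with (uhp_val w) in Es.
        rewrite !extend_UHP in Es. generalize (Hnz w).
        destruct (Hsq w) as [Q | Q]; rewrite Q, ?re_opp, ?im_opp in Es; lra. }
    destruct e1 as [e1 h1], e2 as [e2 h2]; simpl in E. subst e2.
    f_equal. apply proof_irrelevance. }
  subst e2. f_equal. apply proof_irrelevance.
Qed.

Lemma lift_unique (s : Mp2) (Hw : (mp_eta s iH ^ 2)%C = j (mp_g s) iH) :
  s = lift (mp_g s) (mp_eta s iH) Hw.
Proof. apply Mp2_determined; [reflexivity | now rewrite lift_eta_i]. Qed.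

Lemma Cexp_plus (z w : C) : Cexp (z + w) = (Cexp z * Cexp w)%C.
Proof.
  unfold Cexp. rewrite re_plus, im_plus, exp_plus, cos_plus, sin_plus.
  apply injective_projections; simpl; ring.
Qed.

Lemma rot_det (t : R) : cos t * cos t - - sin t * sin t = 1.
Proof. generalize (sin2_cos2 t). unfold Rsqr. lra. Qed.

Definition rot (t : R) : SL2R := mkSL2R (cos t) (- sin t) (sin t) (cos t) (rot_det t).

Lemma diag_det (t : R) : exp t * exp (- t) - 0 * 0 = 1.
Proof. rewrite <- exp_plus, Rplus_opp_r, exp_0. ring. Qed.

Definition diag (t : R) : SL2R := mkSL2R (exp t) 0 0 (exp (- t)) (diag_det t).

Lemma kappa_sq (t : R) : (Cexp (Ci * t / 2) ^ 2)%C = j (rot t) iH.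
Proof.
  replace (Cexp (Ci * t / 2) ^ 2)%C with (Cexp (Ci * t / 2) * Cexp (Ci * t / 2))%C by ring.
  rewrite <- Cexp_plus.
  replace (Ci * t / 2 + Ci * t / 2)%C with (Ci * t)%C by field.
  unfold Cexp, j, jC; simpl.
  replace (0 * t - 1 * 0) with 0 by ring. replace (0 * 0 + 1 * t) with t by ring.
  rewrite exp_0. apply injective_projections; simpl; ring.
Qed.

Lemma h_sq (t : R) : (RtoC (exp (- t / 2)) ^ 2)%C = j (diag t) iH.
Proof.
  rewrite <- RtoC_pow. simpl. rewrite Rmult_1_r, <- exp_plus.
  replace (- t / 2 + - t / 2) with (- t) by field.
  unfold j, jC; simpl. ring.
Qed.

Definition kappa_elt (t : R) : Mp2 := lift (rot t) (Cexp (Ci * t / 2)) (kappa_sq t).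

Definition h_elt (t : R) : Mp2 := lift (diag t) (RtoC (exp (- t / 2))) (h_sq t).

Record Kgrp := mkKgrp { K_val :> Mp2; K_ex : exists t : R, K_val = kappa_elt t }.

Definition kappa (t : R) : Kgrp := mkKgrp (kappa_elt t) (ex_intro _ t eq_refl).

Definition K_angle (x : Kgrp) : R :=
  proj1_sig (constructive_indefinite_description _ (K_ex x)).

(* For half-integral n the value does not depend on the angle chosen by
   [K_angle]; see [chi_kappa]. *)
Definition chi (n : R) (x : Kgrp) : C := Cexp (- (Ci * n * K_angle x)).

Lemma Cexp_i_pow (a : R) (p : nat) : (Cexp (Ci * a) ^ p)%C = Cexp (Ci * (INR p * a)%R).
Proof.
  induction p as [| p IH].
  - simpl. unfold Cexp; simpl.
    replace (0 * (0 * a) - 1 * 0) with 0 by ring.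
    replace (0 * 0 + 1 * (0 * a)) with 0 by ring.
    rewrite exp_0, cos_0, sin_0. apply injective_projections; simpl; ring.
  - rewrite Cpow_S, IH, <- Cexp_plus, S_INR. f_equal.
    rewrite !RtoC_mult, !RtoC_plus. ring.
Qed.

Lemma Cexp_0 : Cexp 0 = RtoC 1.
Proof.
  unfold Cexp; simpl. rewrite exp_0, cos_0, sin_0.
  apply injective_projections; simpl; ring.
Qed.

Lemma Cexp_neq0 (z : C) : Cexp z <> RtoC 0.
Proof.
  intros E. apply C1_nz. rewrite <- Cexp_0.
  replace (RtoC 0) with (z + - z)%C by ring. rewrite Cexp_plus, E. ring.
Qed.

Lemma Cexp_opp (z : C) : Cexp (- z) = (/ Cexp z)%C.
Proof.
  assert (H := Cexp_neq0 z).
  replace (Cexp (- z)) with (Cexp (z + - z) / Cexp z)%C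
    by (rewrite Cexp_plus; field; exact H).
  rewrite Cplus_opp_r, Cexp_0. field. exact H.
Qed.

Lemma Cexp_i_powz (a : R) (N : Z) : Cpowz (Cexp (Ci * a)) N = Cexp (Ci * (IZR N * a)%R).
Proof.
  destruct N as [| p | p]; unfold Cpowz.
  - rewrite Rmult_0_l, Cmult_0_r. now rewrite Cexp_0.
  - rewrite Cexp_i_pow, INR_IPR. reflexivity.
  - rewrite Cexp_i_pow, INR_IPR, <- Cexp_opp. f_equal.
    change (IZR (Zneg p)) with (- IPR p). rewrite !RtoC_mult, RtoC_opp. ring.
Qed.

Lemma chi_kappa (n t : R) :
  half_integral n -> chi n (kappa t) = Cexp (- (Ci * n * t)).
Proof.
  intros [N HN]. unfold chi, K_angle.
  destruct (constructive_indefinite_description _ (K_ex (kappa t))) as [t' Ht'].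
  simpl in *. apply (f_equal (fun s => mp_eta s iH)) in Ht'.
  unfold kappa_elt in Ht'. rewrite !lift_eta_i in Ht'.
  assert (E : forall u : R, Cexp (- (Ci * n * u)) = Cpowz (Cexp (Ci * u / 2)) (- N)).
  { intros u. replace (Ci * u / 2)%C with (Ci * (u / 2)%R)%C.
    - rewrite Cexp_i_powz. f_equal. rewrite opp_IZR, <- HN.
      replace (- (2 * n) * (u / 2)) with (- (n * u)) by field.
      rewrite RtoC_opp, RtoC_mult. ring.
    - rewrite RtoC_div by lra. field. }
  now rewrite !E, Ht'.
Qed.

Definition fkm (k : nat) (m : R) (z : UHP) : C :=
  (Cpow_half (2 * Ci) m * (z - Ci) ^ k / Cpow_half (z + Ci) (m + INR k))%C.

Definition Fkm (k : nat) (m : R) (s : Mp2) : C :=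
  (fkm k m (act (mp_g s) iH) * Cpowz (mp_eta s iH) (- twice m))%C.

(* Main.v *)
(* Write z = g.i and w = eta(i) for the product; the second rotation fixes i, so
   z = kappa_{theta1}.(e^{2t} i).  Then
     F = (sqrt(2i) / (sqrt(z+i) w))^{2m} ((z-i)/(z+i))^k,
   where (z-i)/(z+i) = e^{-2i theta1} tanh t.  The square of the first base is
   that of e^{-i(theta1+theta2)/2} / sqrt(cosh t), and the sign is settled by
   comparing real parts: quotients of square roots of two points in the same
   (open upper or lower) half-plane have positive real part. *)
Require Import Defs.
From Stdlib Require Import Reals.
From Coquelicot Require Import Coquelicot.
From Stdlib Require Import ProofIrrelevance Psatz ZArith.

Open Scope R_scope.

(** * Half-integral powers as natural powers of square roots *)

Lemma Cpowz_of_nat (z : C) (n : nat) : Cpowz z (Z.of_nat n) = (z ^ n)%C.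
Proof. destruct n as [| n]; [reflexivity |]. simpl Cpowz. now rewrite SuccNat2Pos.id_succ. Qed.

Lemma Cpowz_opp_of_nat (z : C) (n : nat) : Cpowz z (- Z.of_nat n) = (/ z ^ n)%C.
Proof.
  destruct n as [| n]; simpl Cpowz.
  - simpl. field.
  - now rewrite SuccNat2Pos.id_succ.
Qed.

Lemma twice_INR (m : R) (n : nat) : 2 * m = INR n -> twice m = Z.of_nat n.
Proof.
  intros H. rewrite INR_IZR_INZ in H. apply eq_IZR.
  rewrite twiceE; [exact H | now exists (Z.of_nat n)].
Qed.

(** * The action on the upper half-plane *)

Lemma UHP_eq (z w : UHP) : uhp_val z = uhp_val w -> z = w.
Proof.
  destruct z as [z Hz], w as [w Hw]; simpl. intros <-. f_equal. apply proof_irrelevance.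
Qed.

Lemma act_mul (g h : SL2R) (z : UHP) : act (SL2R_mul g h) z = act g (act h z).
Proof.
  apply UHP_eq. simpl. unfold mobius at 1.
  assert (Hh := jC_neq0 h z (uhp_pos z)).
  assert (Hg := jC_neq0 g _ (uhp_pos (act h z))). simpl in Hg.
  assert (Hgh := jC_cocycle g h z). unfold j in Hgh. simpl uhp_val in Hgh. rewrite Hgh.
  unfold mobius at 2. field_simplify_eq; [| now split].
  unfold mobius, jC in *. simpl. rewrite !RtoC_plus, !RtoC_mult. field. exact Hh.
Qed.

Lemma plus_Ci_neq0 (z : C) : 0 < Im z -> (z + Ci)%C <> 0%C.
Proof.
  intros Hz E. apply (f_equal Im) in E. rewrite im_plus in E.
  change (Im z + 1 = 0) in E. lra.
Qed.

(** * Fixing signs of square roots by real parts *)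

Lemma Csqr_inj_Re_pos (u v : C) :
  (u * u)%C = (v * v)%C -> 0 < Re u -> 0 < Re v -> u = v.
Proof.
  intros E Hu Hv. destruct (Ceq_dec (u - v) 0) as [D | D]; [now apply Ceq_minus |].
  destruct (Ceq_dec (u + v) 0) as [D' | D'].
  - apply (f_equal Re) in D'. rewrite re_plus in D'. simpl in D'. lra.
  - destruct (Cmult_neq_0 _ _ D D').
    replace ((u - v) * (u + v))%C with (u * u - v * v)%C by ring. rewrite E. ring.
Qed.

(** With roots [a + bi] and [c + di], where [a, c > 0], the imaginary parts of [z] and [w] are [2ab]
    and [2cd]. The hypothesis thus forces [bd > 0], and the real part of the quotient is [ac + bd]
    over a positive number. *)
Lemma Csqrt_div_Re_pos (z w : C) :
  0 < Im z * Im w -> 0 < Re (Csqrt z / Csqrt w).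
Proof.
  intros H.
  assert (Hz : 0 < Re (Csqrt z)) by (apply Csqrt_Re_gt0; right; nra).
  assert (Hw : 0 < Re (Csqrt w)) by (apply Csqrt_Re_gt0; right; nra).
  assert (Ez := f_equal Im (Csqrt_sqr z)). assert (Ew := f_equal Im (Csqrt_sqr w)).
  destruct (Csqrt z) as [a b], (Csqrt w) as [c d].
  rewrite <- Ez, <- Ew in H. simpl in *.
  assert (Hbd : 0 < b * d).
  { replace ((a * b + b * a) * (c * d + d * c)) with (4 * (a * c) * (b * d)) in H by ring.
    assert (0 < a * c) by nra. nra. }
  assert (Hn : 0 < c * (c * 1) + d * (d * 1)) by nra.
  replace (a * (c / (c * (c * 1) + d * (d * 1))) - b * (- d / (c * (c * 1) + d * (d * 1))))
    with ((a * c + b * d) / (c * (c * 1) + d * (d * 1))) by (field; lra).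
  apply Rdiv_lt_0_compat; nra.
Qed.

Lemma Csqrt_RtoC (x : R) : 0 <= x -> Csqrt x = RtoC (sqrt x).
Proof.
  intros Hx. unfold Csqrt. rewrite Cmod_R, Rabs_right by lra. simpl.
  apply injective_projections; simpl.
  - f_equal. lra.
  - replace ((x - x) / 2) with 0 by lra. rewrite sqrt_0.
    destruct (Rle_dec 0 0); lra.
Qed.

(** * Rotations and dilations on the imaginary axis *)

Lemma Cexp_rot (t : R) : Cexp (Ci * t) = (RtoC (cos t) + Ci * sin t)%C.
Proof.
  unfold Cexp; simpl.
  replace (0 * t - 1 * 0) with 0 by ring. replace (0 * 0 + 1 * t) with t by ring.
  rewrite exp_0. apply injective_projections; simpl; ring.
Qed.

Lemma rot_jC_i (t : R) : jC (rot t) Ci = Cexp (Ci * t).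
Proof. rewrite Cexp_rot. unfold jC; simpl. ring. Qed.

Lemma mobius_rot_i (t : R) : mobius (rot t) Ci = Ci.
Proof.
  unfold mobius. assert (H := jC_neq0 (rot t) Ci Rlt_0_1).
  replace (RtoC (ga (rot t)) * Ci + RtoC (gb (rot t)))%C with (Ci * jC (rot t) Ci)%C.
  - field. exact H.
  - unfold jC; simpl. rewrite RtoC_opp.
    apply injective_projections; simpl; ring.
Qed.

Lemma mobius_diag_i (t : R) : mobius (diag t) Ci = (RtoC (exp (2 * t)) * Ci)%C.
Proof.
  unfold mobius, jC; simpl.
  assert (H : RtoC (exp (- t)) <> 0%C).
  { intros E. apply RtoC_inj in E. generalize (exp_pos (- t)). lra. }
  replace (exp t) with (exp (2 * t) * exp (- t)) by (rewrite <- exp_plus; f_equal; ring).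
  rewrite RtoC_mult. field.
  intros E; apply H; rewrite <- E; ring.
Qed.

Lemma cosh_pos (t : R) : 0 < cosh t.
Proof. unfold cosh. generalize (exp_pos t) (exp_pos (- t)). lra. Qed.

(** For a rotation, the numerator of [g.z] plus [i] times its denominator is [e^{i theta} (z + i)];
    here [z = iy]. *)
Lemma jC_rot_mobius_plus_i (theta y : R) :
  0 < y ->
  (jC (rot theta) (y * Ci) * (mobius (rot theta) (y * Ci) + Ci))%C
    = (Ci * (y + 1)%R * Cexp (Ci * theta))%C.
Proof.
  intros Hy. assert (H : jC (rot theta) (y * Ci) <> 0%C) by (apply jC_neq0; simpl; lra).
  rewrite Cexp_rot. unfold mobius. field_simplify_eq; [| exact H].
  unfold jC; simpl. apply injective_projections; simpl; ring.
Qed.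

(** Subtracting [i] times the denominator gives [e^{-i theta} (z - i)] instead. The opposite phases
    produce [e^{-2i theta}] in the ratio [(g.z - i)/(g.z + i)]. *)
Lemma jC_rot_mobius_minus_i (theta y : R) :
  0 < y ->
  (jC (rot theta) (y * Ci) * (mobius (rot theta) (y * Ci) - Ci))%C
    = (Ci * (y - 1)%R * Cexp (- (Ci * theta)))%C.
Proof.
  intros Hy. assert (H : jC (rot theta) (y * Ci) <> 0%C) by (apply jC_neq0; simpl; lra).
  replace (- (Ci * theta))%C with (Ci * RtoC (- theta))%C by (rewrite RtoC_opp; ring).
  rewrite Cexp_rot, cos_neg, sin_neg. unfold mobius. field_simplify_eq; [| exact H].
  unfold jC; simpl. apply injective_projections; simpl; ring.
Qed.

(* The quotient of square roots on the right is eta(e^{2t} i) / eta(i) for kappa_theta. *)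
Lemma Csqrt_rot_quotient (theta t : R) :
  (Csqrt (2 * Ci) / Csqrt (mobius (rot theta) (exp (2 * t) * Ci) + Ci))%C
    = (Csqrt (jC (rot theta) (exp (2 * t) * Ci)) / Csqrt (jC (rot theta) Ci)
       * (exp (- t / 2) / sqrt (cosh t))%R)%C.
Proof.
  set (y := exp (2 * t)). assert (Hy : 0 < y) by apply exp_pos.
  assert (Hyi : 0 < Im (y * Ci)%C) by (simpl; lra).
  assert (Hz := mobius_pos (rot theta) _ Hyi).
  assert (Hjy := jC_neq0 (rot theta) _ Hyi).
  assert (Hj1 := jC_neq0 (rot theta) Ci Rlt_0_1).
  assert (HP := jC_rot_mobius_plus_i theta y Hy).
  rewrite <- rot_jC_i in HP.
  set (z := mobius (rot theta) (y * Ci)) in *.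
  set (jy := jC (rot theta) (y * Ci)) in *. set (j1 := jC (rot theta) Ci) in *.
  assert (Hzi := plus_Ci_neq0 z Hz).
  assert (Hc := cosh_pos t). assert (Hsc := sqrt_lt_R0 _ Hc).
  assert (He := exp_pos (- t / 2)).
  assert (Hr : 0 < exp (- t / 2) / sqrt (cosh t)) by now apply Rdiv_lt_0_compat.
  apply Csqr_inj_Re_pos.
  - transitivity ((Csqrt (2 * Ci) * Csqrt (2 * Ci)) / (Csqrt (z + Ci) * Csqrt (z + Ci)))%C;
      [field; now apply Csqrt_neq0 |].
    transitivity ((Csqrt jy * Csqrt jy) / (Csqrt j1 * Csqrt j1)
       * ((exp (- t / 2) / sqrt (cosh t)) * (exp (- t / 2) / sqrt (cosh t)))%R)%C;
      [| rewrite RtoC_mult; field; now apply Csqrt_neq0].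
    rewrite !Csqrt_sqr.
    (* The square of the real factor is [e^{-t} / cosh t], which is [2 / (y + 1)] for
       [y = e^{2t}]. *)
    replace (exp (- t / 2) / sqrt (cosh t) * (exp (- t / 2) / sqrt (cosh t)))
      with (2 / (y + 1)).
    + rewrite RtoC_div by lra.
      assert (Hy1 : RtoC (y + 1) <> 0%C) by (intros E; apply RtoC_inj in E; lra).
      assert (HCi : Ci <> 0%C) by (intros E; apply (f_equal Im) in E; simpl in E; lra).
      field_simplify_eq; [| now repeat split].
      transitivity (2 * (Ci * RtoC (y + 1) * j1))%C; [ring |]. rewrite <- HP. ring.
    + assert (Hs := sqrt_sqrt (cosh t) (Rlt_le _ _ Hc)).
      transitivity (exp (- t / 2) * exp (- t / 2) / (sqrt (cosh t) * sqrt (cosh t)));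
        [| field; lra].
      rewrite Hs, <- exp_plus. replace (- t / 2 + - t / 2) with (- t) by field.
      unfold cosh in *.
      replace (exp t) with (y * exp (- t)) in *
        by (unfold y; rewrite <- exp_plus; f_equal; ring).
      generalize (exp_pos (- t)). intros. field. split; nra.
  (* Both [2i] and [z + i] lie in the upper half-plane. *)
  - apply Csqrt_div_Re_pos. rewrite im_plus. simpl. simpl in Hz. nra.
  - rewrite re_scal_r. apply Rmult_lt_0_compat; [| exact Hr].
    destruct (Req_dec (sin theta) 0) as [S | S].
    + replace jy with j1.
      * replace (Csqrt j1 / Csqrt j1)%C with (RtoC 1) by (field; now apply Csqrt_neq0).
        simpl. lra.
      * unfold jy, j1, jC. simpl. rewrite S. ring.
    + apply Csqrt_div_Re_pos. unfold jy, j1, jC. simpl.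
      assert (0 < sin theta * sin theta) by nra. nra.
Qed.

(** * Assembling the formula for [Fkm] *)

Lemma tanh_exp (t : R) : tanh t = (exp (2 * t) - 1) / (exp (2 * t) + 1).
Proof.
  unfold tanh, sinh, cosh.
  replace (exp t) with (exp (2 * t) * exp (- t)) by (rewrite <- exp_plus; f_equal; ring).
  generalize (exp_pos (- t)) (exp_pos (2 * t)). intros. field. split; nra.
Qed.

Lemma Cinv_neq0 (z : C) : z <> 0%C -> (/ z)%C <> 0%C.
Proof. intros Hz E. apply C1_nz. rewrite <- (Cinv_r z Hz), E. ring. Qed.

(** Makes the characters comparable with powers of [eta(i)], since [kappa_a] has
    [eta(i) = e^{ia/2}]. *)
Lemma Cexp_half_pow (n a : R) (N : nat) :
  2 * n = INR N -> Cexp (- (Ci * n * a)) = (Cexp (- (Ci * a / 2)) ^ N)%C.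
Proof.
  intros HN.
  replace (- (Ci * a / 2))%C with (Ci * (- a / 2)%R)%C
    by (rewrite RtoC_div, RtoC_opp by lra; field).
  rewrite Cexp_i_pow, <- HN. f_equal.
  replace (2 * n * (- a / 2)) with (- (n * a)) by field.
  rewrite RtoC_opp, RtoC_mult. ring.
Qed.

Theorem lemma4p9 (m : R) (hm : exists l : nat, m = 3 / 2 + INR l) (k : nat)
  (theta1 theta2 t : R) (ht : 0 <= t) :
  Fkm k m (Mp2_mul (Mp2_mul (kappa theta1) (h_elt t)) (kappa theta2)) =
  (chi (m + 2 * INR k) (kappa theta1)
   * (RtoC (tanh t ^ k) / Cpow_half (RtoC (cosh t)) m)
   * chi m (kappa theta2))%C.
Proof.
  destruct hm as [l Hl].
  set (n := (3 + 2 * l)%nat).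
  assert (Hn : 2 * m = INR n).
  { unfold n. rewrite Hl, plus_INR, mult_INR. simpl. lra. }
  assert (Hnk : 2 * (m + INR k) = INR (n + 2 * k)).
  { rewrite plus_INR, mult_INR, <- Hn. simpl. lra. }
  assert (Hm : half_integral m) by (exists (Z.of_nat n); now rewrite <- INR_IZR_INZ).
  assert (Hmk : half_integral (m + 2 * INR k)).
  { exists (Z.of_nat (n + 4 * k)). rewrite <- INR_IZR_INZ, plus_INR, mult_INR, <- Hn. simpl. lra. }
  rewrite !chi_kappa by assumption.
  unfold Fkm, fkm, Cpow_half.
  rewrite (twice_INR _ _ Hn), (twice_INR _ _ Hnk), !Cpowz_of_nat, Cpowz_opp_of_nat.
  rewrite Csqrt_RtoC by (apply Rlt_le, cosh_pos).
  assert (Hact : act (rot theta2) iH = iH) by apply UHP_eq, mobius_rot_i.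
  assert (Hz : uhp_val (act (mp_g (Mp2_mul (Mp2_mul (kappa theta1) (h_elt t)) (kappa theta2))) iH)
    = mobius (rot theta1) (exp (2 * t) * Ci)).
  { simpl mp_g. rewrite !act_mul, Hact. simpl uhp_val. now rewrite mobius_diag_i. }
  rewrite Hz.
  (* Only the factor of [kappa theta1] is evaluated away from [i], namely at [e^{2t} i]; so it alone
     keeps its quotient of square roots. *)
  assert (Heta : mp_eta (Mp2_mul (Mp2_mul (kappa theta1) (h_elt t)) (kappa theta2)) iH =
     (Cexp (Ci * theta1 / 2) / Csqrt (jC (rot theta1) Ci)
       * Csqrt (jC (rot theta1) (exp (2 * t) * Ci)) * exp (- t / 2)
       * Cexp (Ci * theta2 / 2))%C).
  { change (mp_eta (kappa_elt theta1) (act (diag t) (act (rot theta2) iH))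
       * mp_eta (h_elt t) (act (rot theta2) iH) * mp_eta (kappa_elt theta2) iH
      = Cexp (Ci * theta1 / 2) / Csqrt (jC (rot theta1) Ci)
       * Csqrt (jC (rot theta1) (exp (2 * t) * Ci)) * exp (- t / 2)
       * Cexp (Ci * theta2 / 2))%C.
    rewrite Hact. unfold kappa_elt at 2, h_elt. rewrite !lift_eta_i.
    rewrite <- mobius_diag_i. reflexivity. }
  rewrite Heta.
  clear Hz Heta Hact.
  set (y := exp (2 * t)) in *.
  assert (Hy : 0 < y) by apply exp_pos.
  assert (Hyi : 0 < Im (y * Ci)%C) by (simpl; lra).
  assert (HQ := Csqrt_rot_quotient theta1 t). fold y in HQ.
  assert (HX := Csqrt_sqr (mobius (rot theta1) (y * Ci) + Ci)).
  assert (HP := jC_rot_mobius_plus_i theta1 y Hy).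
  assert (HM := jC_rot_mobius_minus_i theta1 y Hy).
  assert (Hjy := jC_neq0 (rot theta1) _ Hyi).
  assert (Hj1 := jC_neq0 (rot theta1) Ci Rlt_0_1).
  assert (Hzi := plus_Ci_neq0 _ (mobius_pos (rot theta1) _ Hyi)).
  assert (HX0 := Csqrt_neq0 _ Hzi).
  set (z := mobius (rot theta1) (y * Ci)) in *.
  set (X := Csqrt (z + Ci)) in *.
  assert (Hs : RtoC (sqrt (cosh t)) <> 0%C).
  { intros E. apply RtoC_inj in E. generalize (sqrt_lt_R0 _ (cosh_pos t)). lra. }
  assert (He : RtoC (exp (- t / 2)) <> 0%C).
  { intros E. apply RtoC_inj in E. generalize (exp_pos (- t / 2)). lra. }
  rewrite (Cexp_half_pow m theta2 n Hn).
  rewrite (Cexp_half_pow (m + 2 * INR k) theta1 (n + 4 * k))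
    by (rewrite plus_INR, mult_INR, <- Hn; simpl; lra).
  rewrite !Cexp_opp.
  rewrite RtoC_pow.
  assert (HE : Cexp (Ci * theta1) = (Cexp (Ci * theta1 / 2) ^ 2)%C).
  { change (Cexp (Ci * theta1) = Cexp (Ci * theta1 / 2) * (Cexp (Ci * theta1 / 2) * 1))%C.
    rewrite Cmult_1_r, <- Cexp_plus. f_equal. field. }
  rewrite Cexp_opp in HM. rewrite HE in HP, HM.
  assert (H1 := Cexp_neq0 (Ci * theta1 / 2)). assert (H2 := Cexp_neq0 (Ci * theta2 / 2)).
  set (E1 := Cexp (Ci * theta1 / 2)) in *. set (E2 := Cexp (Ci * theta2 / 2)) in *.
  set (J := jC (rot theta1) (y * Ci)) in *. set (J1 := jC (rot theta1) Ci) in *.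
  assert (HJ := Csqrt_neq0 _ Hjy). assert (HJ1 := Csqrt_neq0 _ Hj1).
  set (e := exp (- t / 2)) in *. set (s := sqrt (cosh t)) in *.
  rewrite RtoC_div in HQ by (intros E; apply Hs; now rewrite E).
  set (eta := (E1 / Csqrt J1 * Csqrt J * e * E2)%C).
  assert (Heta0 : eta <> 0%C).
  { unfold eta, Cdiv. do 3 (apply Cmult_neq_0; [| assumption]).
    apply Cmult_neq_0; [assumption | now apply Cinv_neq0]. }
  (* [HQ] turns the first quotient into [Csqrt J / Csqrt J1 * (e / s)]; everything but [s] cancels
     against [eta]. *)
  assert (F1 : (Csqrt (2 * Ci) / X / eta = / E1 * / s * / E2)%C).
  { rewrite HQ. unfold eta. field. now repeat split. }
  assert (F2 : ((z - Ci) / (X * X) = tanh t * (/ E1) ^ 4)%C).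
  { rewrite HX, tanh_exp. fold y. rewrite RtoC_div by lra.
    assert (Hy1 : RtoC (y + 1) <> 0%C) by (intros E; apply RtoC_inj in E; lra).
    assert (HCi : Ci <> 0%C) by (intros E; apply (f_equal Im) in E; simpl in E; lra).
    (* Expanding by [J] makes [HP] and [HM] applicable; the quotient of their phases is
       [E1^{-2} / E1^2]. *)
    transitivity ((J * (z - Ci)) / (J * (z + Ci)))%C; [field; now split |].
    rewrite HP, HM. field. now repeat split. }
  (* The denominator has [X] to the power [2(m + k) = n + 2k]: [n] copies join the base of weight
     [m], and the other [2k] form [(X * X)^k], that is [(z + i)^k]. *)
  transitivity ((Csqrt (2 * Ci) / X / eta) ^ n * ((z - Ci) / (X * X)) ^ k)%C.
  - unfold Cdiv. rewrite !Cpow_mult_l, Cpow_add_r, !Cpow_inv by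
      (try assumption; now apply Cmult_neq_0).
    rewrite !Cpow_mult_l, Cpow_mult_r.
    replace ((X ^ 2) ^ k)%C with (X ^ k * X ^ k)%C
      by (rewrite <- Cpow_mult_l; f_equal; ring).
    field. repeat split; now apply Cpow_nz.
  (* [E1] occurs [n] times from [F1] and [4k] times from [F2], in total [2(m + 2k)]: hence the
     character of index [m + 2k]. *)
  - rewrite F1, F2, !Cpow_mult_l, <- Cpow_mult_r, Cpow_add_r, (Cpow_inv s) by assumption.
    unfold Cdiv. ring.
Qed.
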